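(* The entropic entanglement width $E_{\mathrm{wd}}$ is a type II entanglement monotone.
   Context: A subcubic tree is a tree in which every vertex has degree 1 or 3; its degree-1 vertices are leaves. For an $N$-qubit pure state $|\psi\rangle$ on qubits $V=\{1,\dots,N\}$, consider subcubic trees $T$ whose $N$ leaves are identified with the qubits. Deleting an edge $e$ of $T$ leaves two connected components, inducing a bipartition $(A^e_T,B^e_T)$ of $V$. Let $E_{A,B}(|\psi\rangle)=-\mathrm{Tr}(\rho_A\log_2\rho_A)$ with $\rho_A=\mathrm{Tr}_B|\psi\rangle\langle\psi|$. The entropic entanglement width is $E_{\mathrm{wd}}(|\psi\rangle)=\min_T\max_{e\in T}E_{A^e_T,B^e_T}(|\psi\rangle)$, the minimum over all such subcubic trees. For an $N$-qubit $|\psi\rangle$ and an $n$-qubit $|\phi\rangle$, $n\le N$, write $|\psi\rangle\geq_{\mathrm{LOCC}}|\phi\rangle$ if for some set $A$ of $n$ qubits the transformation $|\psi\rangle\to|\phi\rangle^{A}|0\rangle^{\bar A}$ is achievable exactly and with probability one by LOCC (each qubit a separate party). A type II entanglement monotone is a functional $E$ on all $n$-qubit states, all $n$, with $E(|\psi\rangle)\ge E(|\psi'\rangle)$ whenever $|\psi\rangle\geq_{\mathrm{LOCC}}|\psi'\rangle$. *)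

(* Defs.v *)
From HB Require Import structures.
From mathcomp Require Import all_boot all_order all_algebra.
From mathcomp Require Import complex.
From mathcomp Require Import reals exp.
Set Implicit Arguments. Unset Strict Implicit. Unset Printing Implicit Defensive.
Import Order.TTheory GRing.Theory Num.Theory.
Local Open Scope ring_scope.

Section Defs.
Variable R : realType.
Local Notation C := (R[i]).

(* computational basis of N qubits: bit strings 'I_N -> bool *)
Definition qstate (N : nat) := {ffun {ffun 'I_N -> bool} -> C}.

Definition normalized N (psi : qstate N) : Prop :=
  \sum_(x : {ffun 'I_N -> bool}) psi x * (psi x)^* = 1.

Definition log2 (x : R) : R := ln x / ln 2.

Definition eigenvalues n (M : 'M[C]_n) : seq C :=
  sval (closed_field_poly_normal (char_poly M)).

(* - Tr (rho log2 rho) = - sum_lambda lambda log2 lambda (with 0 log 0 = 0,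
   automatic since ln 0 = 0); eigenvalues of a density matrix are real *)
Definition vN_entropy n (M : 'M[C]_n) : R :=
  - \sum_(z <- eigenvalues M) complex.Re z * log2 (complex.Re z).

(* bit strings supported on A (zero outside A) index the basis of qubits A *)
Definition pat N (A : {set 'I_N}) : {set {ffun 'I_N -> bool}} :=
  [set x : {ffun 'I_N -> bool} | [forall i, (i \notin A) ==> ~~ x i]].

Definition merge N (A : {set 'I_N}) (a b : {ffun 'I_N -> bool}) :
  {ffun 'I_N -> bool} := [ffun i => if i \in A then a i else b i].

(* reduced density matrix rho_A = Tr_B |psi><psi|, B = complement of A,
   as a matrix indexed by the basis of the qubits in A *)
Definition rdm N (psi : qstate N) (A : {set 'I_N}) : 'M[C]_#|pat A| :=
  \matrix_(i, j)
    \sum_(b in pat (~: A))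
      psi (merge A (enum_val i) b) * (psi (merge A (enum_val j) b))^*.

Definition ent_AB N (psi : qstate N) (A : {set 'I_N}) : R :=
  vN_entropy (rdm psi A).

Definition deg m (e : rel 'I_m) (x : 'I_m) : nat := #|[set y | e x y]|.

Definition is_tree m (e : rel 'I_m) : Prop :=
  [/\ symmetric e, irreflexive e,
      (forall x y, connect e x y) &
      ~ (exists s : seq 'I_m, [/\ (3 <= size s)%N, uniq s & cycle e s])].

Definition subcubic_tree N m (e : rel 'I_m) (lab : 'I_N -> 'I_m) : Prop :=
  [/\ is_tree e,
      (forall x, deg e x = 1%N \/ deg e x = 3%N),
      injective lab &
      (forall x, deg e x = 1%N <-> exists q, lab q = x)].

Definition del_edge m (e : rel 'I_m) (u v : 'I_m) : rel 'I_m :=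
  [rel x y | e x y && ~~ (((x == u) && (y == v)) || ((x == v) && (y == u)))].

Definition cut_side N m (e : rel 'I_m) (lab : 'I_N -> 'I_m) (u v : 'I_m) :
  {set 'I_N} := [set q | connect (del_edge e u v) u (lab q)].

Definition tree_width N m (e : rel 'I_m) (lab : 'I_N -> 'I_m) (psi : qstate N)
  : R :=
  \big[Num.max/0]_(p : 'I_m * 'I_m | e p.1 p.2)
     ent_AB psi (cut_side e lab p.1 p.2).

(* entropic entanglement width: min over subcubic trees (an infimum of
   finitely many values) *)
Definition Ewd N (psi : qstate N) : R :=
  inf (fun w : R => exists m (e : rel 'I_m) (lab : 'I_N -> 'I_m),
                   subcubic_tree e lab /\ w = tree_width e lab psi).

(* Each party holds its qubit plus a local ancilla: local dimension D >= 2,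
   the qubit being levels 0,1.  Global unnormalised states: *)
Definition dstate N D := {ffun {ffun 'I_N -> 'I_D} -> C}.

Definition apply_local N D (k : 'I_N) (K : 'M[C]_D) (s : dstate N D)
  : dstate N D :=
  [ffun x : {ffun 'I_N -> 'I_D} => \sum_(j : 'I_D) K (x k) j * s [ffun i => if i == k then j else x i]].

Definition complete_kraus D (Ks : seq 'M[C]_D) : Prop :=
  \sum_(K <- Ks) (map_mx Num.conj K)^T *m K = 1%:M.

Definition embed N D (psi : qstate N) : dstate N D :=
  [ffun x : {ffun 'I_N -> 'I_D} => if [forall i, (x i < 2)%N]
             then psi [ffun i => (x i == 1 :> nat)] else 0].

(* |phi>^A |0>^{complement A}, A = image of the injection f : 'I_n -> 'I_N *)
Definition place N n (f : 'I_n -> 'I_N) (phi : qstate n) : qstate N :=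
  [ffun x : {ffun 'I_N -> bool} => if [forall i, (i \notin codom f) ==> ~~ x i]
             then phi [ffun j => x (f j)] else 0].

(* locc_reach Good s: starting from (unnormalised) branch state s, a
   finite-round LOCC protocol ends, on every branch, in a state satisfying
   Good.  Classical communication = every later choice may depend on all
   earlier outcomes (one subderivation per outcome). *)
Inductive locc_reach N D (Good : dstate N D -> Prop) : dstate N D -> Prop :=
| locc_stop s : Good s -> locc_reach Good s
| locc_meas s (k : 'I_N) (Ks : seq 'M[C]_D) :
    complete_kraus Ks ->
    (forall K, K \in Ks -> locc_reach Good (apply_local k K s)) ->
    locc_reach Good s.

(* |psi> >=_LOCC |phi>: exact, probability-one transformation
   psi -> phi^A |0>^{A-bar}; every branch (of nonzero probability) ends in
   the target up to a (global-phase/normalisation) scalar. *)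
Definition locc_geq N n (psi : qstate N) (phi : qstate n) : Prop :=
  exists (f : 'I_n -> 'I_N) (D : nat), [/\ injective f, (2 <= D)%N &
    locc_reach (fun s : dstate N D => exists c : C, s = c *: embed D (place f phi))
               (embed D psi)].

End Defs.

(* Main.v *)
(** Every cut entropy is an LOCC monotone.  Extend the entropy to unnormalised
    states by [F M = t * S (M / t)], [t = tr M].  Then [F] is superadditive on
    positive semidefinite matrices: in an eigenbasis of [M + M'] the left-hand
    side is the classical entropy of the diagonal, the log-sum inequality splits
    it, and passing from the diagonal of [M] to its spectrum only lowers the
    entropy.  A complete measurement outside [A] decomposes the reduced state of
    [A] into the sum of those of the branches; a measurement inside [A] does the
    same for the complement, which has the same nonzero spectrum.  So [F] of the
    initial state dominates the sum of [F] over the branches, and these are all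
    multiples of the target.

    For trees, discarding a leaf that carries no qubit of the target and
    suppressing its neighbour gives a subcubic tree whose cuts are restrictions
    of cuts of the old one, so every tree for the initial state restricts to one
    for the target of at most the same width. *)

Require Import Defs.
From HB Require Import structures.
From mathcomp Require Import all_boot all_order all_algebra.
From mathcomp Require Import complex.
From mathcomp Require Import reals exp.
From mathcomp Require Import sesquilinear spectral.
From mathcomp Require Import ring lra.
Set Implicit Arguments. Unset Strict Implicit. Unset Printing Implicit Defensive.
Import Order.TTheory GRing.Theory Num.Theory.
Local Open Scope ring_scope.
Local Open Scope sesquilinear_scope.

(** * Scalar inequalities *)

Section RealEntropy.
Variable R : realType.
Implicit Types (x y a b p q : R).

Definition xlog x : R := - (x * log2 x).

Lemma ln2_gt0 : 0 < ln (2 : R).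
Proof. by rewrite ln_gt0 // ltr1n. Qed.

Lemma xlog0 : xlog 0 = 0.
Proof. by rewrite /xlog mul0r oppr0. Qed.

Lemma xlogM x y : 0 <= x -> 0 <= y -> xlog (x * y) = x * xlog y + y * xlog x.
Proof.
rewrite !le0r => /predU1P[->|x_gt0]; first by rewrite !mul0r xlog0 mulr0 addr0.
move=> /predU1P[->|y_gt0]; first by rewrite mulr0 xlog0 mulr0 mul0r addr0.
by rewrite /xlog /log2 lnM ?posrE //; ring.
Qed.

Lemma ln_le_sub1 x : 0 < x -> ln x <= x - 1.
Proof.
move=> x_gt0; have := @le_ln1Dx R (x - 1).
by rewrite addrCA subrr addr0; apply; lra.
Qed.

(** Concavity of [xlog]: the right-hand side is its tangent line at [x], evaluated at [y]. For
    [y > 0] this is [ln t <= t - 1] at [t = x / y]. *)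
Lemma xlog_tangent y x : 0 <= y -> 0 < x ->
  xlog y <= - (y * log2 x) + (x - y) / ln 2.
Proof.
have l2 := ln2_gt0.
rewrite le0r => /predU1P[->|y_gt0] x_gt0.
  by rewrite xlog0 mul0r subr0 oppr0 add0r ltW // divr_gt0.
have := ln_le_sub1 (divr_gt0 x_gt0 y_gt0).
rewrite ln_div ?posrE // -(ler_pM2l y_gt0) => h.
rewrite /xlog /log2 -subr_ge0.
have -> : - (y * (ln x / ln 2)) + (x - y) / ln 2 - - (y * (ln y / ln 2)) =
  (y * (x / y - 1) - y * (ln x - ln y)) / ln 2.
  by field; rewrite !gt_eqF.
by apply: divr_ge0; [rewrite subr_ge0 | exact: ltW].
Qed.

(** Jensen's inequality in each row; the unit column sums turn the left-hand side into a sum of row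
    averages. The tangent is taken at the row average, where the linear error terms cancel. *)
Lemma xlog_doubly_stochastic n (P : 'I_n -> 'I_n -> R) (v : 'I_n -> R) :
  (forall i k, 0 <= P i k) -> (forall i, \sum_k P i k = 1) ->
  (forall k, \sum_i P i k = 1) -> (forall k, 0 <= v k) ->
  \sum_k xlog (v k) <= \sum_i xlog (\sum_k P i k * v k).
Proof.
move=> P0 Pr Pc v0.
have -> : \sum_k xlog (v k) = \sum_i \sum_k P i k * xlog (v k).
  rewrite exchange_big; apply: eq_bigr => k _.
  by rewrite -mulr_suml Pc mul1r.
apply: ler_sum => i _; set x := \sum_k P i k * v k.
have Pv0 k : 0 <= P i k * v k by rewrite mulr_ge0.
have : 0 <= x by apply: sumr_ge0.
rewrite le0r => /predU1P[x0|x_gt0].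
  (* There is no tangent at 0, but a zero average forces every [P i k * v k] to vanish, so both
     sides are 0. *)
  rewrite x0 xlog0 big1 // => k _.
  have /eqP := x0; rewrite psumr_eq0 // => /allP/(_ k).
  rewrite mem_index_enum => /(_ isT)/=; rewrite mulf_eq0.
  by case/orP=> /eqP ->; rewrite ?mul0r // xlog0 mulr0.
apply: (@le_trans _ _ (\sum_k P i k * (- (v k * log2 x) + (x - v k) / ln 2))).
  by apply: ler_sum => k _; rewrite ler_wpM2l // xlog_tangent.
have E k : P i k * (- (v k * log2 x) + (x - v k) / ln 2) =
  P i k * (x / ln 2) + P i k * v k * - (log2 x + (ln 2)^-1) by ring.
rewrite (eq_bigr _ (fun k _ => E k)) big_split -!mulr_suml Pr -/x /=.
by rewrite le_eqVlt; apply/orP; left; apply/eqP; rewrite /xlog; ring.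
Qed.

(** The two-term log-sum inequality [a log (p/a) + b log (q/b) <= (a+b) log ((p+q)/(a+b))], written
    without quotients so that zero weights are allowed. *)
Lemma log_sum2 a b p q : 0 <= a -> 0 <= b -> a <= p -> b <= q ->
  xlog a + a * log2 p + (xlog b + b * log2 q) <=
  xlog (a + b) + (a + b) * log2 (p + q).
Proof.
move=> a0 b0 ap bq; have l2 := ln2_gt0.
move: (a0); rewrite le0r => /predU1P[->|a_gt0].
  move: (b0); rewrite le0r => /predU1P[->|b_gt0].
    by rewrite !mul0r !addr0 xlog0 mul0r addr0.
  rewrite xlog0 mul0r !add0r lerD2l ler_pM2l // /log2 ler_pM2r ?invr_gt0 //.
  by rewrite ler_ln ?posrE //; lra.
move: (b0); rewrite le0r => /predU1P[->|b_gt0].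
  rewrite xlog0 mul0r !addr0 lerD2l ler_pM2l // /log2 ler_pM2r ?invr_gt0 //.
  by rewrite ler_ln ?posrE //; lra.
have p_gt0 : 0 < p by lra.
have q_gt0 : 0 < q by lra.
(* Tangents at [p / r] and [q / r]: with this [r] these points sum to [a + b], so the two linear
   errors cancel. *)
set r := (p + q) / (a + b).
have ab_gt0 : 0 < a + b by lra.
have pq_gt0 : 0 < p + q by lra.
have r_gt0 : 0 < r by rewrite divr_gt0.
have key c s : 0 < c -> 0 < s ->
    xlog c + c * log2 s <= c * log2 r + (s / r - c) / ln 2.
  move=> c_gt0 s_gt0; have sr_gt0 : 0 < s / r by rewrite divr_gt0.
  have := xlog_tangent (ltW c_gt0) sr_gt0.
  have -> : log2 (s / r) = log2 s - log2 r.
    by rewrite /log2 ln_div ?posrE // mulrBl.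
  by lra.
apply: (le_trans (lerD (key _ _ a_gt0 p_gt0) (key _ _ b_gt0 q_gt0))).
have -> : log2 (p + q) = log2 r + log2 (a + b).
  by rewrite /log2 -mulrDl -lnM ?posrE // divfK // gt_eqF.
have E : p / r + q / r = a + b.
  by rewrite -mulrDl /r; field; rewrite ?gt_eqF.
rewrite /xlog -subr_ge0.
have -> : - ((a + b) * log2 (a + b)) + (a + b) * (log2 r + log2 (a + b)) -
  (a * log2 r + (p / r - a) / ln 2 + (b * log2 r + (q / r - b) / ln 2)) =
  - ((p / r + q / r - (a + b)) / ln 2) by ring.
by rewrite E subrr mul0r oppr0.
Qed.

(** For nonnegative weights of total [t], this is [t] times the Shannon entropy of [p / t]. *)
Definition shannon n (p : 'I_n -> R) : R :=
  \sum_i xlog (p i) - xlog (\sum_i p i).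

Lemma shannonD n (p q : 'I_n -> R) :
  (forall i, 0 <= p i) -> (forall i, 0 <= q i) ->
  shannon p + shannon q <= shannon (fun i => p i + q i).
Proof.
move=> p0 q0.
(* Distributing the total over the coordinates reduces the claim to one log-sum inequality per
   coordinate. *)
have E (u : 'I_n -> R) :
    shannon u = \sum_i (xlog (u i) + u i * log2 (\sum_j u j)).
  by rewrite /shannon {2}/xlog opprK mulr_suml -big_split.
rewrite !E -big_split /=; apply: ler_sum => i _.
rewrite big_split /=; apply: log_sum2 => //.
  by rewrite (bigD1 i) //= lerDl sumr_ge0.
by rewrite (bigD1 i) //= lerDl sumr_ge0.
Qed.

End RealEntropy.
(** * Entropy of positive semidefinite matrices *)

Section MatrixEntropy.
Variable R : realType.
Local Notation C := (R[i]).

Lemma ReD (x y : C) : complex.Re (x + y) = complex.Re x + complex.Re y.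
Proof. by case: x y => [a b] [c d]. Qed.

Lemma Re_sum I (r : seq I) (P : pred I) (F : I -> C) :
  complex.Re (\sum_(i <- r | P i) F i) = \sum_(i <- r | P i) complex.Re (F i).
Proof. exact: (big_morph _ ReD (erefl _)). Qed.

Lemma Re_ge0 (x : C) : 0 <= x -> 0 <= complex.Re x.
Proof. by rewrite lecE => /andP[]. Qed.

Lemma ReM_real (x y : C) : x \is Num.real ->
  complex.Re (x * y) = complex.Re x * complex.Re y.
Proof.
move=> /RRe_real <-; case: y => a b /=.
by rewrite mul0r subr0.
Qed.

Lemma mulmx_trC m n p (A : 'M[C]_(m, n)) (B : 'M[C]_(n, p)) :
  (A *m B)^t* = B^t* *m A^t*.
Proof. by rewrite trmx_mul map_mxM. Qed.

Lemma eigenvaluesE n (M : 'M[C]_n) :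
  char_poly M = \prod_(z <- eigenvalues M) ('X - z%:P).
Proof.
rewrite /eigenvalues; case: closed_field_poly_normal => s /= E.
by rewrite {1}E (monicP (char_poly_monic M)) scale1r.
Qed.

Lemma vN_entropyE n (M : 'M[C]_n) :
  vN_entropy M = \sum_(z <- eigenvalues M) xlog (complex.Re z).
Proof. by rewrite /vN_entropy -sumrN. Qed.

(** Extra zero eigenvalues cost nothing because [xlog 0 = 0]; the factor ['X^k] allows matrices of
    different sizes to be compared. *)
Lemma vN_entropy_roots n (M : 'M[C]_n) (k : nat) (s : seq C) :
  'X^k * char_poly M = \prod_(z <- s) ('X - z%:P) ->
  vN_entropy M = \sum_(z <- s) xlog (complex.Re z).
Proof.
move=> E; rewrite vN_entropyE.
have P : perm_eq s (nseq k 0 ++ eigenvalues M).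
  apply: prod_XsubC_eq; rewrite -E big_cat /= -eigenvaluesE; congr (_ * _).
  by rewrite big_nseq polyC0 subr0 iter_mulr_1.
by rewrite (perm_big _ P) big_cat /= big_nseq iter_addr xlog0 mul0rn addr0 add0r.
Qed.

(** Sylvester's identity: the block matrix [Z] is made triangular once by a factor on the right and
    once by a factor on the left, and the determinants are compared. *)
Lemma char_poly_mulC m n (A : 'M[C]_(m, n)) (B : 'M[C]_(n, m)) :
  'X^n * char_poly (A *m B) = 'X^m * char_poly (B *m A).
Proof.
rewrite /char_poly /char_poly_mx !map_mxM.
set A' := map_mx _ A; set B' := map_mx _ B.
set Z := block_mx ('X%:M : 'M_m) A' B' 1%:M.
have <- : \det Z = \det ('X%:M - A' *m B').
  have : Z *m block_mx 1%:M 0 (- B') 1%:M = block_mx ('X%:M - A' *m B') A' 0 1%:M.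
    rewrite mulmx_block !mulmx1 !mulmx0 !mul1mx mulmxN !add0r.
    by congr block_mx; rewrite subrr.
  move/(congr1 determinant); rewrite det_mulmx det_lblock det_ublock !det1.
  by rewrite !mulr1.
rewrite -(det_scalar n) -(det_scalar m).
have : block_mx 1%:M 0 (- B') ('X%:M : 'M_n) *m Z =
  block_mx 'X%:M A' 0 ('X%:M - B' *m A').
  rewrite mulmx_block !mul1mx !mul0mx !mulmx1 !addr0 !mulNmx.
  congr block_mx; last by rewrite addrC.
  by rewrite scalar_mxC addNr.
move/(congr1 determinant); rewrite det_mulmx det_lblock det_ublock det1 mul1r.
by [].
Qed.

(** Both products have the same nonzero spectrum. This gives invariance under unitaries and
    isometries, and equality of the entropies of the two sides of a cut. *)
Lemma vN_entropy_mulC m n (A : 'M[C]_(m, n)) (B : 'M[C]_(n, m)) :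
  vN_entropy (A *m B) = vN_entropy (B *m A).
Proof.
pose s := nseq m (0 : C) ++ eigenvalues (B *m A).
have E : 'X^m * char_poly (B *m A) = \prod_(z <- s) ('X - z%:P).
  by rewrite big_cat /= -eigenvaluesE big_nseq polyC0 subr0 iter_mulr_1.
by rewrite (vN_entropy_roots E) (@vN_entropy_roots _ _ n s) // char_poly_mulC.
Qed.

Lemma vN_entropy_diag n (d : 'rV[C]_n) :
  vN_entropy (diag_mx d) = \sum_i xlog (complex.Re (d 0 i)).
Proof.
rewrite (@vN_entropy_roots _ _ 0 [seq d 0 i | i <- index_enum 'I_n]).
  by rewrite big_map.
rewrite mul1r char_poly_trig ?diag_mx_is_trig // big_map.
by apply: eq_bigr => i _; rewrite mxE eqxx.
Qed.

Lemma vN_entropy_diagonalized n (U : 'M[C]_n) (d : 'rV[C]_n) :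
  U \is unitarymx ->
  vN_entropy (U^t* *m diag_mx d *m U) = \sum_i xlog (complex.Re (d 0 i)).
Proof.
by move=> /unitarymxP Uu; rewrite vN_entropy_mulC mulmxA Uu mul1mx vN_entropy_diag.
Qed.

Definition psdmx n (M : 'M[C]_n) : Prop :=
  M^t* = M /\ forall v : 'rV[C]_n, 0 <= (v *m M *m v^t*) 0 0.

Lemma psdmx_gram m n (X : 'M[C]_(m, n)) : psdmx (X *m X^t*).
Proof.
split; first by rewrite mulmx_trC trmxCK.
move=> v; rewrite mulmxA -mulmxA -mulmx_trC; move: (v *m X) => Y.
by rewrite mxE sumr_ge0 // => i _; rewrite !mxE mul_conjC_ge0.
Qed.

Lemma psdmxD n (M M' : 'M[C]_n) : psdmx M -> psdmx M' -> psdmx (M + M').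
Proof.
move=> [hM pM] [hM' pM']; split; first by rewrite linearD map_mxD /= hM hM'.
by move=> v; rewrite mulmxDr mulmxDl mxE addr_ge0.
Qed.

Lemma psdmx0 n : psdmx (0 : 'M[C]_n).
Proof.
split; first by rewrite trmx0 map_mx0.
by move=> v; rewrite mulmx0 mul0mx mxE.
Qed.

Lemma psdmx_diag_ge0 n (M U : 'M[C]_n) i : psdmx M -> 0 <= (U *m M *m U^t*) i i.
Proof.
move=> [_ /(_ (row i U))]; congr (0 <= _).
rewrite -row_mul !mxE; apply: eq_bigr => k _; congr (_ * _).
  by rewrite !mxE.
by rewrite !mxE.
Qed.

Lemma psdmx_spectral n (M : 'M[C]_n) : psdmx M ->
  exists U (d : 'rV[C]_n), [/\ U \is unitarymx, forall i, 0 <= d 0 i &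
    M = U^t* *m diag_mx d *m U].
Proof.
move=> pM; have Uu := spectral_unitarymx M.
have Mn : M \is normalmx by apply/normalmxP; rewrite pM.1.
have /orthomx_spectralP := Mn; rewrite invmx_unitary // => E.
exists (spectralmx M), (spectral_diag M); split => // i.
have := psdmx_diag_ge0 (spectralmx M) i pM.
rewrite {2}E !mulmxA (unitarymxP Uu) mul1mx -mulmxA (unitarymxP Uu) mulmx1.
by rewrite mxE eqxx.
Qed.

(** The diagonal in an orthonormal basis averages the eigenvalues with weights [|W i k|^2], where
    [W] is the unitary change of basis; these weights are doubly stochastic. *)
Lemma vN_entropy_diag_le n (M V : 'M[C]_n) : psdmx M -> V \is unitarymx ->
  vN_entropy M <= \sum_i xlog (complex.Re ((V *m M *m V^t*) i i)).
Proof.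
move=> pM Vu; have [U [d [Uu d0 ->]]] := psdmx_spectral pM.
rewrite vN_entropy_diagonalized //.
set W := V *m U^t*.
have Wu : W \is unitarymx by rewrite mul_unitarymx // trmxC_unitary.
have -> : V *m (U^t* *m diag_mx d *m U) *m V^t* = W *m diag_mx d *m W^t*.
  by rewrite /W mulmx_trC trmxCK !mulmxA.
move: W Wu => {Vu} W Wu; pose P i k := complex.Re (W i k * (W i k)^*).
have -> : \sum_i xlog (complex.Re ((W *m diag_mx d *m W^t*) i i)) =
    \sum_i xlog (\sum_k P i k * complex.Re (d 0 k)).
  apply: eq_bigr => i _; congr xlog; rewrite mxE Re_sum; apply: eq_bigr => k _.
  rewrite mul_mx_diag !mxE mulrAC ReM_real //.
  by rewrite ger0_real // mul_conjC_ge0.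
apply: xlog_doubly_stochastic.
- by move=> i k; apply: Re_ge0; rewrite mul_conjC_ge0.
- move=> i; rewrite -Re_sum.
  have /matrixP/(_ i i) := unitarymxP Wu.
  rewrite !mxE eqxx mulr1n => /(congr1 (@complex.Re R)) /= <-; congr complex.Re.
  by apply: eq_bigr => k _; rewrite !mxE.
- move=> k; rewrite -Re_sum.
  have WTu : W^t* \is unitarymx by rewrite trmxC_unitary.
  have /matrixP/(_ k k) := unitarymxP WTu.
  rewrite trmxCK !mxE eqxx mulr1n => /(congr1 (@complex.Re R)) /= <-; congr complex.Re.
  by apply: eq_bigr => i _; rewrite !mxE mulrC.
- by move=> k; apply: Re_ge0.
Qed.

(* The entropy extended to unnormalised states so as to be homogeneous of
   degree 1: [hentropy M = t * S (M / t)] with [t] the trace of [M]. *)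
Definition hentropy n (M : 'M[C]_n) : R :=
  vN_entropy M - xlog (complex.Re (\tr M)).

Lemma hentropy_mulC m n (A : 'M[C]_(m, n)) (B : 'M[C]_(n, m)) :
  hentropy (A *m B) = hentropy (B *m A).
Proof. by rewrite /hentropy vN_entropy_mulC mxtrace_mulC. Qed.

Lemma hentropy_tr1 n (M : 'M[C]_n) : \tr M = 1 -> hentropy M = vN_entropy M.
Proof.
by rewrite /hentropy => ->; rewrite /xlog /log2 ln1 mul0r mulr0 oppr0 subr0.
Qed.

Lemma hentropyD n (M M' : 'M[C]_n) : psdmx M -> psdmx M' ->
  hentropy M + hentropy M' <= hentropy (M + M').
Proof.
move=> pM pM'; have [U [d [Uu d0 E]]] := psdmx_spectral (psdmxD pM pM').
(* The diagonal of [A] in the eigenbasis of [M + M']. For [M + M'] itself it is the spectrum, so the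
   last step below is an equality. *)
pose p (A : 'M[C]_n) i := complex.Re ((U *m A *m U^t*) i i).
have p0 A : psdmx A -> forall i, 0 <= p A i.
  by move=> pA i; apply/Re_ge0/psdmx_diag_ge0.
have trp A : \sum_i p A i = complex.Re (\tr A).
  rewrite -Re_sum -[X in complex.Re X]/(\tr _) mxtrace_mulC mulmxA.
  have /unitarymxP : U^t* \is unitarymx by rewrite trmxC_unitary.
  by rewrite trmxCK => ->; rewrite mul1mx.
have le A : psdmx A -> hentropy A <= shannon (p A).
  by move=> pA; rewrite /hentropy /shannon trp lerD2r vN_entropy_diag_le.
apply: (le_trans (lerD (le _ pM) (le _ pM'))).
apply: (le_trans (shannonD (p0 _ pM) (p0 _ pM'))).
rewrite le_eqVlt; apply/orP; left; apply/eqP.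
rewrite /hentropy /shannon big_split /= !trp -ReD -mxtraceD; congr (_ - _).
rewrite {1}E vN_entropy_diagonalized //; apply: eq_bigr => i _; congr xlog.
rewrite /p -ReD -[LHS]/(complex.Re (_ + _)).
have -> : (U *m M *m U^t*) i i + (U *m M' *m U^t*) i i = (U *m (M + M') *m U^t*) i i.
  by rewrite mulmxDr mulmxDl [RHS]mxE.
by rewrite E !mulmxA (unitarymxP Uu) mul1mx -mulmxA (unitarymxP Uu) mulmx1 mxE eqxx.
Qed.

Lemma hentropy0 n : hentropy (0 : 'M[C]_n) = 0.
Proof.
rewrite /hentropy mxtrace0 xlog0 subr0 -[0](raddf0 (@diag_mx _ n)) vN_entropy_diag.
by rewrite big1 // => i _; rewrite mxE xlog0.
Qed.

Lemma psdmx_sum n (I : Type) (r : seq I) (M : I -> 'M[C]_n) :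
  (forall i, psdmx (M i)) -> psdmx (\sum_(i <- r) M i).
Proof.
move=> pM; apply: (big_ind (@psdmx n)) => //; first exact: psdmx0.
exact: psdmxD.
Qed.

Lemma hentropy_sum n (I : Type) (r : seq I) (M : I -> 'M[C]_n) :
  (forall i, psdmx (M i)) ->
  \sum_(i <- r) hentropy (M i) <= hentropy (\sum_(i <- r) M i).
Proof.
move=> pM; elim: r => [|i r IH]; first by rewrite !big_nil hentropy0.
rewrite !big_cons; apply: le_trans (hentropyD (pM i) (psdmx_sum r pM)).
by rewrite lerD2l.
Qed.

(** By [xlogM], scaling adds [xlog c] times the trace both to the entropy and to the trace term, and
    the two contributions cancel. *)
Lemma hentropyZ n (M : 'M[C]_n) (c : C) : psdmx M -> 0 <= c ->
  hentropy (c *: M) = complex.Re c * hentropy M.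
Proof.
move=> pM c0; have [U [d [Uu d0 E]]] := psdmx_spectral pM.
have cr : c \is Num.real by rewrite realE c0.
have trd : complex.Re (\tr M) = \sum_i complex.Re (d 0 i).
  rewrite E mxtrace_mulC mulmxA (unitarymxP Uu) mul1mx mxtrace_diag Re_sum //.
have ReMc x : complex.Re (c * x) = complex.Re c * complex.Re x by exact: ReM_real.
have cR := Re_ge0 c0.
rewrite /hentropy mxtraceZ ReMc xlogM //; last first.
  by rewrite trd sumr_ge0 // => i _; apply: Re_ge0.
have -> : c *: M = U^t* *m diag_mx (c *: d) *m U.
  by rewrite E linearZ /= -scalemxAr -scalemxAl.
rewrite trd E !vN_entropy_diagonalized // mulrBr opprD addrA addrAC; congr (_ - _).
rewrite mulr_suml mulr_sumr -sumrB; apply: eq_bigr => i _.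
by rewrite mxE ReMc xlogM ?Re_ge0 //; ring.
Qed.

End MatrixEntropy.
(** * Cut entropies under LOCC *)

Section Locc.
Variables (R : realType) (N D : nat).
Local Notation C := (R[i]).
Local Notation Om := {ffun 'I_N -> 'I_D}.
Local Notation ev := (@enum_val Om predT).
Implicit Types (A : {set 'I_N}) (k : 'I_N) (s : dstate R N D) (a b c : Om).

Lemma sum_ev (F : Om -> C) : \sum_i F (ev i) = \sum_x F x.
Proof. by rewrite -(big_enum_val F); apply: eq_bigl. Qed.

Definition dpat A a : bool := [forall i, (i \notin A) ==> (a i == 0 :> nat)].

Definition dmerge A a b : Om := [ffun i => if i \in A then a i else b i].

Definition upd k j a : Om := [ffun i => if i == k then j else a i].

Definition agree k a b : bool := [forall i, (i != k) ==> (a i == b i)].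

Lemma agreeP k a b : reflect (forall i, i != k -> a i = b i) (agree k a b).
Proof.
apply: (iffP forallP) => h i; first by move=> ik; apply/eqP/(implyP (h i)).
by apply/implyP => ik; rewrite (h i).
Qed.

Lemma agreeC k a b : agree k a b = agree k b a.
Proof. by apply/agreeP/agreeP => h i /h. Qed.

Lemma agree_updl k j a b : agree k (upd k j a) b = agree k a b.
Proof.
apply/agreeP/agreeP => h i ik; have := h i ik; by rewrite ffunE (negPf ik).
Qed.

Lemma sum_agree k a (F : Om -> C) :
  \sum_(b | agree k a b) F b = \sum_j F (upd k j a).
Proof.
rewrite (reindex_onto (fun j => upd k j a) (fun b => b k)) /=; last first.
  move=> b /agreeP h; apply/ffunP => i; rewrite ffunE.
  by case: eqP => [->|/eqP /h].
apply: eq_bigl => j; rewrite ffunE !eqxx andbT.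
by apply/agreeP => i ik; rewrite ffunE (negPf ik).
Qed.

(** [K] on tensor factor [k] and the identity on the others. It acts on the full basis, so its size
    does not depend on any cut. *)
Definition localmx k (K : 'M[C]_D) : 'M[C]_#|Om| :=
  \matrix_(i, j) if agree k (ev i) (ev j) then K (ev i k) (ev j k) else 0.

Lemma localmx_trC k K : (localmx k K)^t* = localmx k (K^t*).
Proof.
apply/matrixP => i j; rewrite !mxE agreeC.
by case: ifP; rewrite ?rmorph0.
Qed.

Lemma localmxM k K K' : localmx k K *m localmx k K' = localmx k (K *m K').
Proof.
apply/matrixP => i j; rewrite !mxE.
transitivity (\sum_b (if agree k (ev i) b then K (ev i k) (b k) else 0) *
   (if agree k b (ev j) then K' (b k) (ev j k) else 0)).
  by rewrite -sum_ev; apply: eq_bigr => l _; rewrite !mxE.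
transitivity (\sum_(b | agree k (ev i) b) K (ev i k) (b k) *
   (if agree k b (ev j) then K' (b k) (ev j k) else 0)).
  rewrite [RHS]big_mkcond; apply: eq_bigr => b _.
  by case: ifP; rewrite ?mul0r.
rewrite sum_agree; case: ifP => h; last first.
  by rewrite big1 // => l _; rewrite agree_updl h mulr0.
by apply: eq_bigr => l _; rewrite agree_updl h ffunE eqxx.
Qed.

Lemma localmx_sum k I (r : seq I) (K : I -> 'M[C]_D) :
  localmx k (\sum_(i <- r) K i) = \sum_(i <- r) localmx k (K i).
Proof.
apply: (big_morph (localmx k)) => [K1 K2|]; apply/matrixP => i j; rewrite !mxE.
  by case: ifP; rewrite ?addr0.
by rewrite if_same.
Qed.

Lemma localmx1 k : localmx k 1%:M = 1%:M.
Proof.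
apply/matrixP => i j; rewrite !mxE -(inj_eq enum_val_inj).
case: agreeP => [h|nh]; last first.
  case: eqP => // e; case: nh => l _; by rewrite e.
congr (_%:R); congr nat_of_bool; apply/eqP/eqP => [e|->//].
apply/ffunP => l; by have [->|/h] := eqVneq l k.
Qed.

Lemma complete_localmx k (Ks : seq 'M[C]_D) : complete_kraus Ks ->
  \sum_(K <- Ks) (localmx k K)^t* *m localmx k K = 1%:M.
Proof.
rewrite /complete_kraus -(localmx1 k) => <-; rewrite localmx_sum.
by apply: eq_bigr => K _; rewrite localmx_trC localmxM map_trmx.
Qed.

(* The amplitudes of [s] as a matrix from the parties outside [A] to those in
   [A]; the patterns are padded by level 0, and other entries vanish. *)
Definition amp A s : 'M[C]_#|Om| :=
  \matrix_(i, j) if dpat A (ev i) && dpat (~: A) (ev j)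
                 then s (dmerge A (ev i) (ev j)) else 0.

Lemma amp_tr A s : (amp A s)^T = amp (~: A) s.
Proof.
apply/matrixP => i j; rewrite !mxE setCK andbC; case: ifP => // _; congr (s _).
by apply/ffunP => l; rewrite !ffunE inE; case: (l \in A).
Qed.

Lemma dpat_upd A k j a : k \in A -> dpat A (upd k j a) = dpat A a.
Proof.
move=> kA; apply/forallP/forallP => h i; apply/implyP => iA;
  have := implyP (h i) iA; rewrite ffunE; case: (i =P k) => // e;
  by rewrite e kA in iA.
Qed.

(** Row indices describe the parties in [A], so such a party acts on the left; the padding condition
    does not constrain level [k], hence it survives the action. *)
Lemma amp_apply_local A k K s : k \in A ->
  amp A (apply_local k K s) = localmx k K *m amp A s.
Proof.
move=> kA; apply/matrixP => i j; rewrite !mxE.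
transitivity (\sum_(b | agree k (ev i) b) K (ev i k) (b k) *
   (if dpat A b && dpat (~: A) (ev j) then s (dmerge A b (ev j)) else 0)).
  rewrite sum_agree; case: ifP => h; last first.
    by rewrite big1 // => l _; rewrite dpat_upd // h mulr0.
  rewrite ffunE; apply: eq_bigr => l _; rewrite dpat_upd // h !ffunE kA eqxx.
  congr (_ * s _); apply/ffunP => m; rewrite !ffunE.
  by case: (eqVneq m k) => [->|]; rewrite ?kA.
rewrite big_mkcond -sum_ev; apply: eq_bigr => l _; rewrite !mxE.
by case: ifP; rewrite ?mul0r.
Qed.

Lemma amp_apply_localC A k K s : k \notin A ->
  amp A (apply_local k K s) = amp A s *m (localmx k K)^T.
Proof.
rewrite -in_setC => kA; rewrite -[amp A s]trmxK amp_tr -trmx_mul.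
by rewrite -amp_apply_local // amp_tr setCK.
Qed.

Lemma ampZ A (x : C) s : amp A (x *: s) = x *: amp A s.
Proof.
apply/matrixP => i j; rewrite !mxE; case: ifP; rewrite ?mulr0 //.
by rewrite ffunE.
Qed.

(** The unnormalised reduced state of [A], padded by zeros to the full basis. *)
Definition gram A s := amp A s *m (amp A s)^t*.

Lemma psdmx_ampC A s : psdmx ((amp A s)^t* *m amp A s).
Proof. by have := psdmx_gram ((amp A s)^t*); rewrite trmxCK. Qed.

(** The matrix on the right is, up to transposition, the reduced state of the complement of [A]. *)
Lemma gram_ampC A s :
  hentropy (gram A s) = hentropy ((amp A s)^t* *m amp A s) /\
  \tr (gram A s) = \tr ((amp A s)^t* *m amp A s).
Proof. by rewrite /gram hentropy_mulC mxtrace_mulC. Qed.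

(** The operators act on the column side of [amp], so completeness enters in transposed form between
    the two factors. *)
Lemma sum_gram_notin A k (Ks : seq 'M[C]_D) s : k \notin A -> complete_kraus Ks ->
  \sum_(K <- Ks) gram A (apply_local k K s) = gram A s.
Proof.
move=> kA /(complete_localmx k) E.
transitivity (amp A s *m (\sum_(K <- Ks) (localmx k K)^t* *m localmx k K)^T
              *m (amp A s)^t*); last by rewrite E trmx1 mulmx1.
rewrite linear_sum mulmx_sumr mulmx_suml; apply: eq_bigr => K _.
rewrite /gram amp_apply_localC // mulmx_trC !mulmxA; congr (_ *m _).
by rewrite -!mulmxA; congr (_ *m _); rewrite /= trmx_mul map_trmx.
Qed.

Lemma sum_gram_in A k (Ks : seq 'M[C]_D) s : k \in A -> complete_kraus Ks ->
  \sum_(K <- Ks) (amp A (apply_local k K s))^t* *m amp A (apply_local k K s) =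
  (amp A s)^t* *m amp A s.
Proof.
move=> kA /(complete_localmx k) E.
transitivity ((amp A s)^t* *m (\sum_(K <- Ks) (localmx k K)^t* *m localmx k K)
              *m amp A s); last by rewrite E mulmx1.
rewrite mulmx_sumr mulmx_suml; apply: eq_bigr => K _.
by rewrite amp_apply_local // mulmx_trC !mulmxA.
Qed.

(** The reduced state on the side of the cut that is not measured is the sum over the branches, and
    superadditivity applies to that side. *)
Lemma hentropy_measure A k (Ks : seq 'M[C]_D) s : complete_kraus Ks ->
  \sum_(K <- Ks) hentropy (gram A (apply_local k K s)) <= hentropy (gram A s).
Proof.
move=> cK; have [kA|kA] := boolP (k \in A).
  rewrite (gram_ampC A s).1 -(sum_gram_in s kA cK).
  under eq_bigr do rewrite (gram_ampC A _).1.
  by apply: hentropy_sum => K; apply: psdmx_ampC.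
rewrite -(sum_gram_notin s kA cK); apply: hentropy_sum => K.
exact: psdmx_gram.
Qed.

Lemma mxtrace_measure A k (Ks : seq 'M[C]_D) s : complete_kraus Ks ->
  \sum_(K <- Ks) \tr (gram A (apply_local k K s)) = \tr (gram A s).
Proof.
move=> cK; have [kA|kA] := boolP (k \in A).
  rewrite (gram_ampC A s).2 -(sum_gram_in s kA cK) [RHS]linear_sum.
  by apply: eq_bigr => K _; rewrite (gram_ampC A _).2.
by rewrite -(sum_gram_notin s kA cK) [RHS]linear_sum.
Qed.

(** Induction on the protocol. The trace of [gram A s] is the weight of the branch; the bound is
    linear in it, so the bounds over the outcomes add up. A final branch [c *: t] has weight [|c|^2]
    and gives equality, also for [c = 0]. *)
Lemma locc_hentropy A (t s : dstate R N D) :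
  complex.Re (\tr (gram A t)) = 1 ->
  locc_reach (fun u => exists c : C, u = c *: t) s ->
  complex.Re (\tr (gram A s)) * hentropy (gram A t) <= hentropy (gram A s).
Proof.
move=> t1; elim=> {s} [_ [c ->]|s k Ks cK _ IH].
  have -> : gram A (c *: t) = (c * c^*) *: gram A t.
    rewrite /gram ampZ linearZ /= map_mxZ -scalemxAl -scalemxAr scalerA.
    by rewrite mulrC.
  have cr : 0 <= c * c^* by rewrite mul_conjC_ge0.
  rewrite hentropyZ //; last exact: psdmx_gram.
  by rewrite mxtraceZ ReM_real ?ger0_real // t1 mulr1.
apply: le_trans (hentropy_measure A k s cK).
rewrite -(mxtrace_measure A k s cK) Re_sum mulr_suml big_seq [leRHS]big_seq.
by apply: ler_sum => K /IH.
Qed.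

Lemma locc_vN_entropy A (t s : dstate R N D) :
  \tr (gram A t) = 1 -> \tr (gram A s) = 1 ->
  locc_reach (fun u => exists c : C, u = c *: t) s ->
  vN_entropy (gram A t) <= vN_entropy (gram A s).
Proof.
move=> t1 s1 reach; have := locc_hentropy (congr1 (@complex.Re R) t1) reach.
have E (x h h' v v' : R) : x = 1 -> h = v -> h' = v' -> x * h <= h' -> v <= v'.
  by move=> -> -> ->; rewrite mul1r.
exact: E (congr1 (@complex.Re R) s1) (hentropy_tr1 t1) (hentropy_tr1 s1).
Qed.

End Locc.

(** * Placed qubit states and the entropies of their cuts *)

Section Placement.
Variables (R : realType) (n N d : nat) (f : 'I_n -> 'I_N).
Hypothesis f_inj : injective f.
Local Notation C := (R[i]).
Local Notation D := d.+2.
Local Notation Om := {ffun 'I_N -> 'I_D}.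
Local Notation bits := {ffun 'I_n -> bool}.
Implicit Types (A : {set 'I_N}) (B : {set 'I_n}) (x y w : bits) (phi : qstate R n).

(** The basis string at which the placed and embedded state carries the amplitude of [x]: the bits
    of [x] along [f], level 0 elsewhere. *)
Definition lift_bits x : Om :=
  [ffun i => if [pick j | f j == i] is Some j then inord (x j) else ord0].

Lemma lift_bits_f x j : lift_bits x (f j) = x j :> nat.
Proof.
rewrite ffunE; case: pickP => [l /eqP /f_inj ->|/(_ j)]; last by rewrite eqxx.
by rewrite inordK //; case: (x j).
Qed.

Lemma lift_bits_notin x i : i \notin codom f -> lift_bits x i = 0 :> nat.
Proof.
rewrite ffunE; case: pickP => [l /eqP <-|//]; by rewrite codom_f.
Qed.

Lemma codom_case i : (exists j, i = f j) \/ i \notin codom f.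
Proof.
by have [/codomP|] := boolP (i \in codom f); [left|right].
Qed.

Lemma lift_bits_eqP x (a : Om) :
  reflect ((forall j, a (f j) = x j :> nat) /\
           (forall i, i \notin codom f -> a i = 0 :> nat)) (a == lift_bits x).
Proof.
apply: (iffP eqP) => [->|[h1 h2]].
  by split=> [j|i]; [rewrite lift_bits_f | move/lift_bits_notin].
apply/ffunP => i; apply: val_inj => /=; have [[j ->]|iN] := codom_case i.
  by rewrite h1 lift_bits_f.
by rewrite h2 // lift_bits_notin.
Qed.

Lemma lift_bits_inj : injective lift_bits.
Proof.
move=> x y e; apply/ffunP => j; have := lift_bits_f x j.
by rewrite e lift_bits_f; case: (x j); case: (y j).
Qed.

Lemma embed_place_lift phi x : embed D (place f phi) (lift_bits x) = phi x.
Proof.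
rewrite !ffunE ifT; last first.
  apply/forallP => i; have [[j ->]|iN] := codom_case i.
    by rewrite lift_bits_f; case: (x j).
  by rewrite lift_bits_notin.
rewrite ifT; last first.
  apply/forallP => i; apply/implyP => iN.
  by rewrite ffunE lift_bits_notin.
congr (phi _); apply/ffunP => j; rewrite 2!ffunE lift_bits_f.
by case: (x j).
Qed.

Lemma embed_place_neq0 phi (a : Om) : embed D (place f phi) a != 0 ->
  exists x, a = lift_bits x.
Proof.
rewrite !ffunE; case: ifP => [/forallP a2|_]; last by rewrite eqxx.
case: ifP => [/forallP aN|_ ]; last by rewrite eqxx.
move=> _; exists [ffun j => a (f j) == 1 :> nat]; apply/eqP/lift_bits_eqP; split.
  by move=> j; rewrite ffunE; have := a2 (f j); case: (nat_of_ord _) => [|[]].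
move=> i iN; have := implyP (aN i) iN; rewrite ffunE; have := a2 i.
by case: (nat_of_ord _) => [|[]].
Qed.

Definition bitmask B w : bits := [ffun i => (i \in B) && w i].

Lemma bitmask_pat B w : bitmask B w \in pat B.
Proof.
rewrite inE; apply/forallP => i; apply/implyP => iB.
by rewrite ffunE (negPf iB).
Qed.

Lemma patP B x : reflect (forall i, i \notin B -> x i = false) (x \in pat B).
Proof.
rewrite inE; apply: (iffP forallP) => h i.
  by move=> iB; apply/negbTE/(implyP (h i)).
by apply/implyP => /h ->.
Qed.

Definition liftmx B : 'M[C]_(#|Om|, #|pat B|) :=
  \matrix_(i, j) (enum_val i == lift_bits (enum_val j))%:R.

Lemma liftmx_isometry B : (liftmx B)^t* *m liftmx B = 1%:M.
Proof.
apply/matrixP => i j; rewrite !mxE.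
rewrite (bigD1 (enum_rank (lift_bits (enum_val i)))) //= !mxE enum_rankK eqxx.
rewrite rmorph1 mul1r (inj_eq lift_bits_inj) (inj_eq enum_val_inj).
rewrite big1 ?addr0 // => l nl; rewrite !mxE.
case: eqP => [e|_]; last by rewrite rmorph0 mul0r.
by rewrite -e enum_valK eqxx in nl.
Qed.

Definition qamp phi B : 'M[C]_(#|pat B|, #|pat (~: B)|) :=
  \matrix_(i, j) phi (Defs.merge B (enum_val i) (enum_val j)).

Lemma rdmE phi B : rdm phi B = qamp phi B *m (qamp phi B)^t*.
Proof.
apply/matrixP => i j; rewrite !mxE big_enum_val /=.
by apply: eq_bigr => l _; rewrite !mxE.
Qed.

(** Qubits outside the image of [f] are in level 0, so the amplitude matrix is that of [phi] for the
    preimage cut, between two isometries. *)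
Lemma amp_embed_place A phi :
  amp A (embed D (place f phi)) =
  liftmx (f @^-1: A) *m qamp phi (f @^-1: A) *m (liftmx (~: (f @^-1: A)))^T.
Proof.
set B := f @^-1: A; apply/matrixP => i j; rewrite !mxE.
set a := enum_val i; set b := enum_val j.
transitivity (\sum_(y in pat (~: B)) (\sum_(x in pat B)
    (a == lift_bits x)%:R * phi (Defs.merge B x y)) * (b == lift_bits y)%:R); last first.
  rewrite big_enum_val /=; apply: eq_bigr => l _.
  rewrite !mxE; congr (_ * _); rewrite big_enum_val /=.
  by apply: eq_bigr => m _; rewrite !mxE.
have memB l : (f l \in A) = (l \in B) by rewrite inE.
have dpat_lift A' x : x \in pat (f @^-1: A') -> dpat A' (lift_bits x).
  move=> /patP xB; apply/forallP => l; apply/implyP => lA.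
  have [[m e]|lN] := codom_case l; last by rewrite lift_bits_notin.
  by rewrite e lift_bits_f xB // inE -e.
(* If both indices are lifts of patterns, injectivity of [lift_bits] leaves one term of the double
   sum; otherwise both sides vanish. *)
case: (pickP [pred p : bits * bits | [&& p.1 \in pat B, p.2 \in pat (~: B),
    a == lift_bits p.1 & b == lift_bits p.2]]) => [[x y] /=|none].
  case/and4P=> xB yB /eqP aE /eqP bE.
  rewrite (bigD1 y) //= (bigD1 x) //= !aE !bE !eqxx mul1r mulr1.
  rewrite !big1 ?addr0; first last.
  - move=> x' /andP[_ /negPf x'x]; rewrite (inj_eq lift_bits_inj) eq_sym x'x.
    by rewrite mul0r.
  - move=> y' /andP[_ /negPf y'y]; rewrite (inj_eq lift_bits_inj) (eq_sym y) y'y.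
    by rewrite mulr0.
  rewrite !dpat_lift //= ?preimsetC //.
  rewrite -embed_place_lift; congr (embed _ _ _); apply/eqP/lift_bits_eqP; split.
    move=> l; rewrite [dmerge _ _ _ _]ffunE [Defs.merge _ _ _ _]ffunE memB.
    by case: ifP; rewrite lift_bits_f.
  by move=> l lN; rewrite [dmerge _ _ _ _]ffunE; case: ifP; rewrite lift_bits_notin.
rewrite [RHS]big1 => [|y yB]; last first.
  case: (b =P _) => [bE|]; last by rewrite mulr0.
  rewrite big1 ?mul0r // => x xB; case: (a =P _) => [aE|]; last by rewrite mul0r.
  by have := none (x, y); rewrite /= xB yB aE bE !eqxx.
case: ifP => // /andP[/forallP pa /forallP pb]; apply/eqP/negPn/negP.
(* A nonzero entry would make the merged string a lift of some [w], whose two masks are then a pair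
   of the kind just excluded. *)
move=> /embed_place_neq0[w wE].
have ab l : (if l \in A then a l else b l) = lift_bits w l by rewrite -wE ffunE.
have := none (bitmask B w, bitmask (~: B) w); rewrite /= !bitmask_pat /=.
move=> /negbT/negP; apply; apply/andP; split; apply/lift_bits_eqP; split => [l|l lN].
- rewrite ffunE -memB; have := ab (f l); have := implyP (pa (f l)).
  by case: ifP => /= [_ _ ->|_ /(_ isT) /eqP ->//]; rewrite lift_bits_f.
- have := ab l; have := implyP (pa l).
  by case: ifP => /= [_ _ ->|_ /(_ isT) /eqP ->//]; rewrite lift_bits_notin.
- rewrite ffunE inE -memB; have := ab (f l); have := implyP (pb (f l)).
  by rewrite inE; case: ifP => /= [_ /(_ isT) /eqP ->//|_ _ ->]; rewrite lift_bits_f.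
- have := ab l; have := implyP (pb l); rewrite inE.
  by case: ifP => /= [_ /(_ isT) /eqP ->//|_ _ ->]; rewrite lift_bits_notin.
Qed.

Lemma gram_embed_place A phi :
  gram A (embed D (place f phi)) =
  liftmx (f @^-1: A) *m rdm phi (f @^-1: A) *m (liftmx (f @^-1: A))^t*.
Proof.
rewrite /gram amp_embed_place rdmE; set B := f @^-1: A.
rewrite !mulmx_trC !mulmxA; congr (_ *m _ *m _).
rewrite -[RHS]mulmx1 -mulmxA; congr (_ *m _).
by rewrite -[RHS]trmx1 -(liftmx_isometry (~: B)) trmx_mul /= map_trmx.
Qed.

(** The isometries only add zeros to the spectrum. *)
Lemma ent_AB_gram A phi :
  ent_AB phi (f @^-1: A) = vN_entropy (gram A (embed D (place f phi))).
Proof.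
rewrite gram_embed_place -mulmxA vN_entropy_mulC -mulmxA liftmx_isometry mulmx1.
by [].
Qed.

Lemma mxtrace_rdm phi B : \tr (rdm phi B) = \sum_x phi x * (phi x)^*.
Proof.
transitivity (\sum_(x in pat B) \sum_(y in pat (~: B))
   phi (Defs.merge B x y) * (phi (Defs.merge B x y))^*).
  rewrite big_enum_val /=.
  by apply: eq_bigr => i _; rewrite mxE.
rewrite pair_big /= [RHS](reindex_onto (fun p : bits * bits => Defs.merge B p.1 p.2)
  (fun w => (bitmask B w, bitmask (~: B) w))) /=; last first.
  by move=> w _; apply/ffunP => l; rewrite !ffunE inE; case: (l \in B).
apply: eq_bigl => -[x y] /=; apply/andP/eqP => [[/patP xB /patP yB]|[<- <-]].
  congr (_, _); apply/ffunP => l; rewrite !ffunE ?inE.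
    by have := xB l; case: (l \in B) => //= ->.
  by have := yB l; rewrite inE; case: (l \in B) => //= ->.
by rewrite !bitmask_pat.
Qed.

Lemma mxtrace_gram A phi : normalized phi ->
  \tr (gram A (embed D (place f phi))) = 1.
Proof.
move=> phi1; rewrite gram_embed_place -mulmxA mxtrace_mulC -mulmxA.
by rewrite liftmx_isometry mulmx1 mxtrace_rdm.
Qed.

End Placement.

Lemma place_id (R : realType) N (psi : qstate R N) : place id psi = psi.
Proof.
apply/ffunP => x; rewrite ffunE ifT.
  by congr (psi _); apply/ffunP => i; rewrite ffunE.
by apply/forallP => i; have -> : i \in codom id by exact: (codom_f id i).
Qed.

(** The only fact about LOCC that the tree argument uses. The initial state is treated as placed
    along the identity, so both ends of the protocol are covered by the same lemmas. *)
Lemma ent_AB_locc (R : realType) (N n D : nat) (f : 'I_n -> 'I_N)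
  (psi : qstate R N) (phi : qstate R n) (A : {set 'I_N}) :
  injective f -> (2 <= D)%N -> normalized psi -> normalized phi ->
  locc_reach (fun s : dstate R N D => exists c : R[i], s = c *: embed D (place f phi))
    (embed D psi) ->
  ent_AB phi (f @^-1: A) <= ent_AB psi A.
Proof.
case: D => [|[|d]] // f_inj _ psi1 phi1 reach.
have psiE : ent_AB psi A = vN_entropy (gram A (embed d.+2 psi)).
  have := ent_AB_gram d (@inj_id 'I_N) A psi; rewrite place_id => <-.
  by congr ent_AB; apply/setP => i; rewrite inE.
have s1 : \tr (gram A (embed d.+2 psi)) = 1.
  by have := mxtrace_gram d (@inj_id 'I_N) A psi1; rewrite place_id.
rewrite psiE (ent_AB_gram d f_inj).
exact: locc_vN_entropy (mxtrace_gram d f_inj A phi1) s1 reach.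
Qed.
(** * Subcubic trees *)

Section Connect.
Variables (T T' : finType).

Lemma homo_connect (e : rel T) (e' : rel T') (h : T -> T') :
  (forall x y, e x y -> connect e' (h x) (h y)) ->
  forall x y, connect e x y -> connect e' (h x) (h y).
Proof.
move=> he x _ /connectP[p pp ->]; elim: p x pp => //= y p IH x /andP[exy pp].
exact: connect_trans (he _ _ exy) (IH _ pp).
Qed.

End Connect.

Section CubicTrees.
Implicit Types T : finType.

(** This and the next two definitions are [deg], [del_edge] and [cut_side] over an arbitrary finite
    type, since tree surgery passes to subtypes and sum types. *)
Definition nbr_count T (e : rel T) (x : T) : nat := #|[set y | e x y]|.

Definition cut_edge T (e : rel T) (u v : T) : rel T :=
  [rel x y | e x y && ~~ (((x == u) && (y == v)) || ((x == v) && (y == u)))].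

Definition cut_labels T (e : rel T) n (lab : 'I_n -> T) (u v : T) : {set 'I_n} :=
  [set q | connect (cut_edge e u v) u (lab q)].

(** Acyclicity is expressed by every edge being a bridge: this speaks of the same cut graphs as the
    bipartitions and is easy to transport along contractions. *)
Record cubic_tree T (e : rel T) : Prop := CubicTree {
  cubic_sym : symmetric e;
  cubic_irr : irreflexive e;
  cubic_connect : forall x y, connect e x y;
  cubic_bridge : forall u v, e u v -> ~~ connect (cut_edge e u v) u v;
  cubic_deg : forall x, nbr_count e x = 1%N \/ nbr_count e x = 3%N
}.

Lemma cut_edge_sym T (e : rel T) u v : symmetric e -> symmetric (cut_edge e u v).
Proof.
move=> se x y; rewrite /cut_edge /= se; congr (_ && ~~ _).
by rewrite orbC [(x == u) && _]andbC [(x == v) && _]andbC.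
Qed.

Lemma cut_edge_connect_sym T (e : rel T) u v :
  symmetric e -> connect_sym (cut_edge e u v).
Proof. by move=> se; apply/sym_connect_sym/cut_edge_sym. Qed.

Lemma acyclic_bridge T (e : rel T) : symmetric e -> irreflexive e ->
  ~ (exists s : seq T, [/\ (3 <= size s)%N, uniq s & cycle e s]) ->
  forall u v, e u v -> ~~ connect (cut_edge e u v) u v.
Proof.
move=> se ie acyc u v euv; apply/negP => /connectP[p0 /shortenP[p pp up _] vE].
have sub : subrel (cut_edge e u v) e by move=> x y /andP[].
apply: acyc; exists (u :: p); split=> //.
  (* The closed walk has at least three vertices: an empty path would make a loop, and a single step
     would be the deleted edge. *)
  case: p pp vE {up} => [|z [|//]] /=; first by move=> _ vE; rewrite vE ie in euv.
  by rewrite andbT => h vE; move: h; rewrite /cut_edge /= -vE !eqxx andbF.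
rewrite /= rcons_path (sub_path sub pp) /= -vE se euv //.
Qed.

Lemma bridge_acyclic T (e : rel T) : symmetric e ->
  (forall u v, e u v -> ~~ connect (cut_edge e u v) u v) ->
  ~ (exists s : seq T, [/\ (3 <= size s)%N, uniq s & cycle e s]).
Proof.
move=> se bri [[|x [|y [|z p]]] []] // _ us /= /and3P[exy eyz pp].
have eyx : e y x by rewrite se.
(* The rest of the cycle leads from [y] back to [x]; it never returns to [y], so it avoids the edge
   between them. *)
case/negP: (bri _ _ eyx); apply/connectP; exists (z :: rcons p x); last first.
  by rewrite /= last_rcons.
have /and3P[xN yN _] := us.
have zx : (z == x) = false.
  by apply/negbTE; apply: contraNneq xN => ->; rewrite !inE eqxx orbT.
have yx : (y == x) = false by apply/negbTE; apply: contraNneq xN => ->; rewrite !inE eqxx.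
apply/andP; split; first by rewrite /cut_edge /= eyz eqxx zx yx.
apply: (@sub_in_path _ (predC1 y) e) pp.
  by move=> a b /negPf ay /negPf bY eab; rewrite /cut_edge /= eab ay bY andbF.
have : y \notin z :: rcons p x.
  by move: yN; rewrite !inE mem_rcons inE yx /= .
by rewrite -has_pred1 -all_predC.
Qed.

Lemma cubic_tree_ord T (e : rel T) n (lab : 'I_n -> T) :
  cubic_tree e -> injective lab ->
  (forall x, nbr_count e x = 1%N <-> exists q, lab q = x) ->
  exists m (e' : rel 'I_m) (lab' : 'I_n -> 'I_m),
    subcubic_tree e' lab' /\
    forall u v, e' u v -> exists u0 v0,
      e u0 v0 /\ cut_side e' lab' u v = cut_labels e lab u0 v0.
Proof.
move=> [se ie ce be de] labI labP.
have [h [g [gh hg]]] : exists (h : 'I_#|T| -> T) g, cancel h g /\ cancel g h.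
  by exists enum_val, enum_rank; split; [exact: enum_valK | exact: enum_rankK].
have hI : injective h := can_inj gh.
pose e' : rel 'I_#|T| := [rel i j | e (h i) (h j)].
have deg' i : deg e' i = nbr_count e (h i).
  rewrite /deg /nbr_count -(card_imset _ hI); apply: eq_card => y.
  apply/imsetP/idP => [[j]|]; first by rewrite !inE => ? ->.
  by rewrite inE => ey; exists (g y); rewrite ?hg // inE /e' /= hg.
have cut' u v i j : connect (del_edge e' u v) i j =
    connect (cut_edge e (h u) (h v)) (h i) (h j).
  apply/idP/idP.
    apply: homo_connect => {}i {}j c; apply: connect1; move: c.
    by rewrite /del_edge /cut_edge /= !(inj_eq hI).
  move=> c; rewrite -(gh i) -(gh j); apply: homo_connect c => a b c.
  apply: connect1; move: c; rewrite /del_edge /cut_edge /e' /= !hg.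
  by rewrite -!(inj_eq hI) !hg.
exists #|T|, e', (g \o lab); split; last first.
  move=> u v euv; exists (h u), (h v); split=> //; apply/setP => q.
  by rewrite !inE cut' /= hg.
split.
- split.
  + by move=> i j; apply: se.
  + by move=> i; apply: ie.
  + move=> i j; rewrite -(gh i) -(gh j); apply: homo_connect (ce (h i) (h j)).
    by move=> a b eab; apply: connect1; rewrite /e' /= !hg.
  + apply: bridge_acyclic; first by move=> i j; apply: se.
    by move=> u v euv; rewrite [connect _ _ _]cut' be.
- by move=> i; rewrite deg'.
- exact: inj_comp (can_inj hg) labI.
- move=> i; rewrite deg' labP; split=> -[q qE]; exists q; first by rewrite /= qE gh.
  by rewrite -qE /= hg.
Qed.

(** * Removing a leaf [x] and suppressing its neighbour [y], whose other neighbours are [a] and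
    [b] *)

Section RemoveLeaf.
Variables (T : finType) (e : rel T).
Hypothesis tree : cubic_tree e.
Variables (x y a b : T).
Hypothesis nbr_x : forall z, e x z = (z == y).
Hypothesis nbr_y : forall z, e y z = [|| z == x, z == a | z == b].
Hypothesis (ax : a != x) (bx : b != x) (ab : a != b).

Let se := cubic_sym tree.
Let ie := cubic_irr tree.

Let ay : a != y. Proof. by apply/eqP => E; have := nbr_y a; rewrite eqxx orbT E ie. Qed.
Let by_ : b != y. Proof. by apply/eqP => E; have := nbr_y b; rewrite eqxx !orbT E ie. Qed.
Let eya : e y a. Proof. by rewrite nbr_y eqxx orbT. Qed.
Let eyb : e y b. Proof. by rewrite nbr_y eqxx !orbT. Qed.

(** Otherwise the detour through [y] would bypass the bridge from [a] to [b]. Hence the edge added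
    by [smooth] is new. *)
Let eab : e a b = false.
Proof.
apply/negbTE/negP => h; case/negP: (cubic_bridge tree h).
apply: (@connect_trans _ _ y); apply: connect1; rewrite /cut_edge /=.
  by rewrite se eya /= [y == b]eq_sym (negPf by_) [y == a]eq_sym (negPf ay) !andbF.
by rewrite eyb /= [y == b]eq_sym (negPf by_) [y == a]eq_sym (negPf ay).
Qed.

Definition smooth_vertex : finType := {z : T | (z != x) && (z != y)}.
Local Notation T' := smooth_vertex.

Definition smooth : rel T' := [rel z w : T' |
  [|| e (sval z) (sval w), (sval z == a) && (sval w == b) |
      (sval z == b) && (sval w == a)]].

Let valNx (z : T') : (sval z == x) = false. Proof. by case/andP: (valP z) => /negPf. Qed.
Let valNy (z : T') : (sval z == y) = false. Proof. by case/andP: (valP z) => _ /negPf. Qed.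

Let old_vertex z : z != x -> z != y -> {w : T' | sval w = z}.
Proof.
move=> zx zy; have zP : (z != x) && (z != y) by rewrite zx.
by exists (Sub z zP).
Qed.

Let e_y (z : T') : e (sval z) y -> (sval z == a) || (sval z == b).
Proof. by rewrite se nbr_y valNx. Qed.

Let smooth_sym : symmetric smooth.
Proof.
move=> z w; rewrite /smooth /= se [(sval w == a) && _]andbC.
by rewrite [(sval w == b) && _]andbC [X in _ || X]orbC.
Qed.

(* Contracting [x] and [y] into a neighbour [c] of [y] carries walks of [e] to
   walks of [smooth]. *)
Lemma contract_connect (r : rel T) (r' : rel T') (c : T') :
  subrel r e -> connect_sym r' ->
  (forall z w : T', r (sval z) (sval w) -> connect r' z w) ->
  (forall z : T', r (sval z) y || r y (sval z) -> connect r' c z) ->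
  forall z w : T', connect r (sval z) (sval w) -> connect r' z w.
Proof.
move=> sr sr' h1 h2.
pose pi z : T' := insubd c z.
have piK (z : T') : pi (sval z) = z := valKd c z.
have pic z : (z == x) || (z == y) -> pi z = c.
  move=> zxy; rewrite /pi /insubd insubF //.
  by case/orP: zxy => ->; rewrite ?andbF.
move=> z w c0; rewrite -(piK z) -(piK w); apply: homo_connect c0 => u v ruv.
have euv := sr _ _ ruv.
have [uxy|] := boolP ((u == x) || (u == y)).
  have [vxy|] := boolP ((v == x) || (v == y)).
    by rewrite !pic // connect0.
  rewrite negb_or => /andP[vx vy]; have [v' vE] := old_vertex vx vy.
  rewrite pic // -vE piK; apply: h2; rewrite vE.
  case/orP: uxy => /eqP uE; last by rewrite uE in ruv; rewrite ruv orbT.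
  by rewrite uE nbr_x in euv; rewrite euv in vy.
rewrite negb_or => /andP[ux uy]; have [u' uE] := old_vertex ux uy.
have [vxy|] := boolP ((v == x) || (v == y)).
  rewrite [pi v]pic // -uE piK sr'; apply: h2; rewrite uE.
  case/orP: vxy => /eqP vE; last by rewrite vE in ruv; rewrite ruv.
  by rewrite vE se nbr_x in euv; rewrite euv in uy.
rewrite negb_or => /andP[vx vy]; have [v' vE] := old_vertex vx vy.
by rewrite -uE -vE !piK; apply: h1; rewrite uE vE.
Qed.

Lemma smooth_connect (z w : T') : connect smooth z w.
Proof.
have [a' aE] := old_vertex ax ay.
apply: (@contract_connect e smooth a') (cubic_connect tree _ _) => //.
- exact: sym_connect_sym.
- by move=> u v euv; apply: connect1; rewrite /smooth /= euv.
move=> u; rewrite se orbb nbr_y valNx /= => /orP[/eqP uE|/eqP uE].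
  by have -> : u = a' by [exact/val_inj/(etrans uE (esym aE))]; exact: connect0.
by apply: connect1; rewrite /smooth /= aE uE !eqxx orbT.
Qed.

(** An old edge is cut as before, with [v0] equal to [v]; the new edge corresponds to the old edge
    from [u] to [y]. That [v] lies on the side of [v0] is what carries the bridge property over. *)
Lemma smooth_cut (u v : T') : smooth u v -> exists v0,
  [/\ e (sval u) v0, connect (cut_edge e (sval u) v0) (sval v) v0 &
   forall z w : T', connect (cut_edge smooth u v) z w =
     connect (cut_edge e (sval u) v0) (sval z) (sval w)].
Proof.
have [a' aE] := old_vertex ax ay.
have eba : e b a = false by rewrite se.
have valE (z w : T') : (z == w) = (sval z == sval w) by [].
have yv (z : T') : (y == sval z) = false by rewrite eq_sym valNy.
have [euv _|neuv] := boolP (e (sval u) (sval v)).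
  (* Old edge: a step along the new edge is replaced by the detour through [y]; conversely, [x] and
     [y] are contracted into [a]. *)
  exists (sval v); split=> // z w; apply/idP/idP.
    apply: homo_connect => {}z {}w.
    case/andP=> /or3P[ezw|/andP[/eqP zE /eqP wE]|/andP[/eqP zE /eqP wE]].
    - by move=> h; apply: connect1; rewrite /cut_edge /= ezw.
    - move=> _; rewrite zE wE; apply: (@connect_trans _ _ y); apply: connect1.
        by rewrite /cut_edge /= se eya !yv !andbF.
      by rewrite /cut_edge /= eyb !yv.
    - move=> _; rewrite zE wE; apply: (@connect_trans _ _ y); apply: connect1.
        by rewrite /cut_edge /= se eyb !yv !andbF.
      by rewrite /cut_edge /= eya !yv.
  apply: (@contract_connect _ _ a').
  - by move=> ? ? /andP[].
  - exact: cut_edge_connect_sym.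
  - move=> s t /andP[est h]; apply: connect1.
    by rewrite /cut_edge /smooth /= est.
  - move=> s; rewrite [cut_edge e _ _ _ y](cut_edge_sym _ _ se) orbb.
    move=> /andP[]; rewrite nbr_y valNx /= => /orP[/eqP sE _|/eqP sE _].
      by have -> : s = a' by [exact/val_inj/(etrans sE (esym aE))]; exact: connect0.
    apply: connect1; rewrite /cut_edge /smooth /= aE sE !eqxx orbT /= !valE aE sE.
    (* The new edge is not the deleted one, since the deleted one belongs to [e]. *)
    apply/negP => /orP[] /andP[/eqP E1 /eqP E2]; move: euv.
      by rewrite -E1 -E2 eab.
    by rewrite -E1 -E2 eba.
rewrite /smooth /= (negPf neuv) /= => uv.
have uyE : e (sval u) y.
  by case/orP: uv => /andP[/eqP -> _]; rewrite se.
have vyE : e (sval v) y.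
  by case/orP: uv => /andP[_ /eqP ->]; rewrite se.
have vu : (sval v == sval u) = false.
  by case/orP: uv => /andP[/eqP -> /eqP ->]; rewrite ?(negPf ab) // eq_sym (negPf ab).
exists y; split=> //.
  by apply: connect1; rewrite /cut_edge /= vyE vu valNy.
move=> z w; apply/idP/idP.
  apply: homo_connect => {}z {}w /andP[szw h]; apply: connect1.
  rewrite /cut_edge /= !valNy !andbF /= andbT.
  case/or3P: szw => // /andP[zE wE]; case/negP: h; move: zE wE uv;
    by rewrite !valE => /eqP -> /eqP ->; rewrite ![a == _]eq_sym ![b == _]eq_sym;
       case/orP=> /andP[-> ->]; rewrite ?orbT.
(* With the edge from [u] to [y] deleted, [y] remains attached to [v], so the contraction goes into
   [v]. *)
apply: (@contract_connect _ _ v).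
- by move=> ? ? /andP[].
- exact: cut_edge_connect_sym.
- move=> s t /andP[est _]; apply: connect1; rewrite /cut_edge /smooth /= est /= !valE.
  apply/negP => /orP[] /andP[/eqP E1 /eqP E2]; move: est; rewrite E1 E2 ?(negPf neuv) //.
  by rewrite se (negPf neuv).
- move=> s; rewrite [cut_edge e _ _ _ y](cut_edge_sym _ _ se) orbb.
  move=> /andP[]; rewrite nbr_y valNx /= eqxx [y == sval u]eq_sym valNy /= => sab su.
  have -> : s = v; last exact: connect0.
  apply: val_inj => /=; case/orP: uv => /andP[/eqP uE /eqP vE]; rewrite vE;
    by case/orP: sab su => /eqP -> //; rewrite uE eqxx.
Qed.

Lemma smooth_nbr_count (z : T') : nbr_count smooth z = nbr_count e (sval z).
Proof.
have [a' aE] := old_vertex ax ay; have [b' bE] := old_vertex bx by_.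
(* A bijection from new neighbours to old ones: the neighbour reached through the new edge is sent
   to [y]. *)
pose sg (w : T') := if e (sval z) (sval w) then sval w else y.
rewrite /nbr_count -(@card_in_imset _ _ sg); last first.
  move=> w w'; rewrite !inE /smooth /sg /=.
  case: ifP => [_ _|_ /= h]; case: ifP => [_ _|_ /= h'].
  - exact: val_inj.
  - by move/eqP; rewrite valNy.
  - by move/eqP; rewrite eq_sym valNy.
  - move=> _; apply: val_inj => /=; case/orP: h => /andP[/eqP zE /eqP ->];
      by move: h'; rewrite zE eqxx ?[b == a]eq_sym (negPf ab) ?orbF /= => /eqP ->.
apply: eq_card => t; apply/imsetP/idP => [[w]|].
  rewrite !inE /smooth /sg /=; case: ifP => [ezw _ ->//|_ /= h ->].
  by case/orP: h => /andP[/eqP -> _]; rewrite se.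
rewrite inE => ezt.
have tx : t != x by apply/eqP => tE; rewrite tE se nbr_x valNy in ezt.
have [tE|ty] := eqVneq t y.
  rewrite tE in ezt *; case/orP: (e_y ezt) => /eqP zE.
    by exists b'; rewrite ?inE /smooth /sg /= bE zE ?eqxx ?orbT // eab.
  by exists a'; rewrite ?inE /smooth /sg /= aE zE ?eqxx ?orbT // se eab.
have [t' t'E] := old_vertex tx ty.
by exists t'; rewrite ?inE /smooth /sg /= t'E ezt.
Qed.

Lemma smooth_cubic_tree : cubic_tree smooth.
Proof.
split.
- exact: smooth_sym.
- move=> z; rewrite /smooth /= ie /=.
  by apply/negP => /orP[] /andP[/eqP ->]; rewrite ?(negPf ab) // eq_sym (negPf ab).
- exact: smooth_connect.
- move=> u v /smooth_cut[v0 [euv0 cv cE]]; rewrite cE.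
  by apply/negP => c; case/negP: (cubic_bridge tree euv0); apply: connect_trans c cv.
- by move=> z; rewrite smooth_nbr_count; apply: cubic_deg.
Qed.

Lemma card_smooth_vertex : (#|T'| < #|T|)%N.
Proof.
rewrite card_sig; apply: proper_card; apply/properP; split.
  exact/subsetP.
by exists x; rewrite // inE eqxx.
Qed.

Lemma smooth_cut_labels n (lab : 'I_n -> T) (lab' : 'I_n -> T') :
  (forall q, sval (lab' q) = lab q) -> forall u v, smooth u v ->
  exists u0 v0, e u0 v0 /\ cut_labels smooth lab' u v = cut_labels e lab u0 v0.
Proof.
move=> labE u v /smooth_cut[v0 [euv0 _ cE]]; exists (sval u), v0; split=> //.
by apply/setP => q; rewrite !inE cE labE.
Qed.

End RemoveLeaf.

(** Induction on the number of vertices, removing one unlabelled leaf at a time. When none is left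
    the labels are exactly the leaves. *)
Lemma restrict_cubic_tree n T (e : rel T) (lab : 'I_n -> T) : (2 <= n)%N ->
  cubic_tree e -> injective lab -> (forall q, nbr_count e (lab q) = 1%N) ->
  exists m (e' : rel 'I_m) (lab' : 'I_n -> 'I_m),
    subcubic_tree e' lab' /\
    forall u v, e' u v -> exists u0 v0,
      e u0 v0 /\ cut_side e' lab' u v = cut_labels e lab u0 v0.
Proof.
move=> n2; have [k] := ubnP #|T|; elim: k T e lab => // k IH T e lab Tk tree labI lab1.
have [/existsP[x /andP[/eqP x1 xN]]|/existsPn all] :=
  boolP [exists x, (nbr_count e x == 1)%N && (x \notin codom lab)]; last first.
  apply: cubic_tree_ord => // x; split=> [x1|[q <-]//].
  have := all x; rewrite x1 eqxx /= negbK => /codomP[q ->]; by exists q.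
have labx q : lab q != x by apply: contraNneq xN => <-; apply: codom_f.
have /cards1P[y yE] : #|[set z | e x z]| == 1%N by apply/eqP.
have nbr_x z : e x z = (z == y) by have /setP/(_ z) := yE; rewrite !inE.
have eyx : e y x by rewrite (cubic_sym tree) nbr_x.
(* If [y] is a leaf too, the tree is a single edge and all labels sit at [y], which two distinct
   labels cannot do. *)
have [y1|y3] := cubic_deg tree y.
  have /cards1P[x' x'E] : #|[set z | e y z]| == 1%N by apply/eqP.
  have nbr_y z : e y z = (z == x).
    have /setP/(_ x) := x'E; rewrite !inE eyx => /esym/eqP ->.
    by have /setP/(_ z) := x'E; rewrite !inE.
  have only z : (z == x) || (z == y).
    have cl : closed e (pred2 x y).
      apply: (intro_closed (sym_connect_sym (cubic_sym tree))) => s t est.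
      rewrite !inE => /orP[] /eqP sE; move: est;
        by rewrite sE ?nbr_x ?nbr_y => ->; rewrite ?orbT.
    have := closed_connect cl (cubic_connect tree x z).
    by rewrite !inE eqxx => /esym.
  have laby q : lab q = y by have := only (lab q); rewrite (negPf (labx q)) => /eqP.
  have := labI (Ordinal (ltnW n2)) (Ordinal n2); rewrite !laby => /(_ erefl).
  by move/(congr1 val).
have : #|[set z | e y z] :\ x| == 2%N.
  have := cardsD1 x [set z | e y z]; rewrite inE eyx -[X in X = _]/(nbr_count e y) y3 add1n.
  by move=> [<-].
case/cards2P=> a [b [ab abE]].
have nbr_y z : e y z = [|| z == x, z == a | z == b].
  have /setP/(_ z) := abE; rewrite !inE; case: eqP => [->|_] //= -> //.
have aN : (a != x) && e y a by have /setP/(_ a) := abE; rewrite !inE eqxx.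
have bN : (b != x) && e y b by have /setP/(_ b) := abE; rewrite !inE eqxx orbT.
case/andP: aN => ax eya; case/andP: bN => bx eyb.
have labP q : (lab q != x) && (lab q != y).
  by rewrite labx /=; apply/eqP => E; have := lab1 q; rewrite E y3.
pose lab' q : smooth_vertex x y := Sub (lab q) (labP q).
have labE q : sval (lab' q) = lab q by [].
have tree' := smooth_cubic_tree tree nbr_x nbr_y ax bx ab.
have [||||m [e' [l' [sub cuts]]]] := IH _ (smooth e a b) lab'.
- by apply: leq_trans (card_smooth_vertex x y) _.
- exact: tree'.
- by move=> q q' /(congr1 val) /labI.
- by move=> q; rewrite (smooth_nbr_count tree nbr_x nbr_y ax bx ab) labE.
exists m, e', l'; split=> // u v /cuts[u1 [v1 [s1 ->]]].
exact: (smooth_cut_labels tree nbr_x nbr_y ax ab labE).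
Qed.

(** * Enlarging a tree at a leaf *)

Section GrowLeaf.
Variables (T : finType) (e : rel T) (x : T).
Hypotheses (tree : cubic_tree e) (x1 : nbr_count e x = 1%N).

(** The two elements of [bool] become new leaves attached to [x], whose degree rises from 1 to 3. *)
Definition grow : rel (T + bool) := fun z w => match z, w with
  | inl u, inl v => e u v
  | inl u, inr _ | inr _, inl u => u == x
  | inr _, inr _ => false
  end.

Lemma grow_sym : symmetric grow.
Proof. by move=> [u|?] [v|?] //=; rewrite (cubic_sym tree). Qed.

Lemma grow_nbr_countE z : nbr_count grow z =
  (#|[set v | grow z (inl v)]| + (grow z (inr true) + grow z (inr false)))%N.
Proof.
rewrite /nbr_count -!sum1dep_card big_mkcond big_sumType /= -big_mkcond /=.
by rewrite big_bool; do 2 case: (grow _ _).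
Qed.

Lemma grow_nbr_countl u : nbr_count grow (inl u) = (nbr_count e u + (u == x).*2)%N.
Proof. by rewrite grow_nbr_countE /= addnn. Qed.

Lemma grow_nbr_countr c : nbr_count grow (inr c) = 1%N.
Proof.
rewrite grow_nbr_countE; have -> : [set v | grow (inr c) (inl v)] = [set x].
  by apply/setP => v; rewrite !inE.
by rewrite cards1.
Qed.

Lemma grow_cubic_tree : cubic_tree grow.
Proof.
have inlc u v : connect grow (inl u) (inl v).
  apply: homo_connect (cubic_connect tree u v) => {}u {}v euv.
  exact: connect1.
have toroot z : connect grow z (inl x).
  by case: z => [u|c]; rewrite ?inlc //; apply: connect1; rewrite /= eqxx.
have gsym := grow_sym.
split=> //.
- by case=> // u; apply: (cubic_irr tree).
- move=> z w; apply: connect_trans (toroot z) _.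
  by rewrite (sym_connect_sym gsym).
(* A new leaf is isolated once its edge is deleted. *)
- have new c w : connect (cut_edge grow (inl x) (inr c)) (inr c) w -> w = inr c.
    move=> /connectP[[|t p] /=]; first by move=> _ ->.
    case/andP=> /andP[]; case: t => // u /= /eqP ->.
    by rewrite !eqxx.
  case=> [u|c] [v|c'] //=.
  + move=> euv; apply/negP => c; case/negP: (cubic_bridge tree euv).
    (* Retracting the new leaves to [x] turns a walk avoiding an old edge into such a walk in the
       old tree. *)
    pose pi (z : T + bool) := if z is inl t then t else x.
    change (connect (cut_edge e u v) (pi (inl u)) (pi (inl v))).
    apply: homo_connect c => -[s|?] [t|?] //=.
    * by rewrite /cut_edge /= => c; apply: connect1.
    * by rewrite /cut_edge /= => /andP[/eqP ->].
    * by rewrite /cut_edge /= => /andP[/eqP ->].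
  + move=> /eqP ->; rewrite (cut_edge_connect_sym _ _ gsym).
    by apply/negP => /new.
  + move=> /eqP ->; apply/negP => c0.
    suff /new : connect (cut_edge grow (inl x) (inr c)) (inr c) (inl x) by [].
    rewrite -(eq_connect (e := cut_edge grow (inr c) (inl x))) // => s t.
    by rewrite /cut_edge /= orbC.
- case=> [u|c]; last by rewrite grow_nbr_countr; left.
  rewrite grow_nbr_countl; case: eqP => [->|_]; first by rewrite x1; right.
  by rewrite addn0; apply: cubic_deg.
Qed.

(** The leaf [x] is lost and two are gained. *)
Lemma card_grow_leaves : (#|[set u | nbr_count e u == 1%N]| <
  #|[set z | nbr_count grow z == 1%N]|)%N.
Proof.
rewrite -[X in (_ < X)%N]sum1dep_card big_mkcond big_sumType /= big_bool /=.
rewrite !grow_nbr_countr /= addn2 ltnS -big_mkcond /= sum1dep_card.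
rewrite (cardsD1 x) inE x1 eqxx add1n ltnS; apply: subset_leq_card.
apply/subsetP => u; rewrite !inE grow_nbr_countl => /andP[/negPf ->].
by rewrite addn0.
Qed.

End GrowLeaf.

Lemma exists_cubic_tree n : exists (T : finType) (e : rel T),
  cubic_tree e /\ (n.+2 <= #|[set u | nbr_count e u == 1%N]|)%N.
Proof.
elim: n => [|n [T [e [tree le]]]].
  pose e : rel bool := [rel u v | u != v].
  have deg1 u : nbr_count e u = 1%N.
    rewrite /nbr_count -sum1dep_card big_mkcond big_bool /=.
    by case: u.
  exists bool, e; split; last first.
    rewrite (_ : [set u | _] = setT) ?cardsT ?card_bool //.
    by apply/setP => u; rewrite !inE deg1.
  split.
  - by move=> [] [].
  - by case.
  - by move=> [] []; rewrite ?connect0 //; apply: connect1.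
  - move=> u v uv; apply/negP => /connectP[[|w p] /=].
      by move=> _ vE; move: uv; rewrite vE /e /= eqxx.
    by case/andP; case: u uv => /=; case: v; case: w.
  - by move=> u; left.
have /card_gt0P[x] : (0 < #|[set u | nbr_count e u == 1%N]|)%N.
  exact: leq_trans le.
rewrite inE => /eqP x1; exists (T + bool)%type, (grow e x); split.
  exact: grow_cubic_tree.
exact: leq_ltn_trans le (card_grow_leaves x1).
Qed.

End CubicTrees.

(** * Tree widths and monotonicity of the entanglement width *)

Lemma tree_width_ge0 (R : realType) N m (e : rel 'I_m) (lab : 'I_N -> 'I_m)
  (psi : qstate R N) : 0 <= tree_width e lab psi.
Proof. exact: bigmax_ge_id. Qed.

Lemma subcubic_cubic_tree N m (e : rel 'I_m) (lab : 'I_N -> 'I_m) :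
  subcubic_tree e lab -> cubic_tree e.
Proof.
by move=> [[se ie ce acyc] de _ _]; split=> //; apply: acyclic_bridge.
Qed.

(** A tree with more than [N] leaves is grown, [N] of them are labelled, and the surplus is pruned
    by [restrict_cubic_tree]. *)
Lemma exists_subcubic_tree N : (2 <= N)%N ->
  exists m (e : rel 'I_m) (lab : 'I_N -> 'I_m), subcubic_tree e lab.
Proof.
move=> N2; have [T [e [tree le]]] := exists_cubic_tree N.
pose leaves := [set u | nbr_count e u == 1%N].
have leN : (N <= #|leaves|)%N by apply: leq_trans le; rewrite -addn2 leq_addr.
pose lab (q : 'I_N) : T := enum_val (widen_ord leN q).
have labI : injective lab by move=> q q' /enum_val_inj /(congr1 val) /= /val_inj.
have lab1 q : nbr_count e (lab q) = 1%N.
  by have := enum_valP (widen_ord leN q); rewrite inE => /eqP.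
have [m [e' [lab' [sub _]]]] := restrict_cubic_tree N2 tree labI lab1.
by exists m, e', lab'.
Qed.

Lemma restrict_tree_width (R : realType) N n m (f : 'I_n -> 'I_N)
  (psi : qstate R N) (phi : qstate R n) (e : rel 'I_m) (lab : 'I_N -> 'I_m) :
  (2 <= n)%N -> injective f ->
  (forall A : {set 'I_N}, ent_AB phi (f @^-1: A) <= ent_AB psi A) ->
  subcubic_tree e lab ->
  exists m' (e' : rel 'I_m') (lab' : 'I_n -> 'I_m'),
    subcubic_tree e' lab' /\ tree_width e' lab' phi <= tree_width e lab psi.
Proof.
move=> n2 f_inj ent_le tr; have [_ _ labI labP] := tr.
have [|q|m' [e' [lab' [sub cuts]]]] :=
  @restrict_cubic_tree n _ e (lab \o f) n2 (subcubic_cubic_tree tr).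
- exact: inj_comp labI f_inj.
- by apply/labP; exists (f q).
exists m', e', lab'; split=> //; apply: bigmax_le => [|[u v] /= euv].
  (* The default value 0 of the maximum must also be bounded. *)
  exact: tree_width_ge0.
have [u0 [v0 [e0 ->]]] := cuts u v euv.
have -> : cut_labels e (lab \o f) u0 v0 = f @^-1: cut_side e lab u0 v0.
  by apply/setP => q; rewrite !inE.
apply: le_trans (ent_le _) _.
exact: (@le_bigmax_cond _ _ _ _ (u0, v0) (fun p => e p.1 p.2)
  (fun p => ent_AB psi (cut_side e lab p.1 p.2))).
Qed.

Theorem theorem3 (R : realType) (N n : nat) (psi : qstate R N) (phi : qstate R n) :
  (2 <= n)%N -> normalized psi -> normalized phi ->
  locc_geq psi phi -> Ewd phi <= Ewd psi.
Proof.
move=> n2 psi1 phi1 [f [D [f_inj D2 reach]]].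
have N2 : (2 <= N)%N.
  by apply: leq_trans n2 _; have := leq_card f f_inj; rewrite !card_ord.
have ent_le A := ent_AB_locc A f_inj D2 psi1 phi1 reach.
(* The infimum for [psi] has to be over a nonempty set, whence the existence of a tree; the infimum
   for [phi] needs the lower bound 0. *)
apply: lb_le_inf.
  have [m [e [lab sub]]] := exists_subcubic_tree N2.
  by exists (tree_width e lab psi), m, e, lab.
move=> w [m [e [lab [sub ->]]]].
have [m' [e' [lab' [sub' le]]]] := restrict_tree_width n2 f_inj ent_le sub.
apply: le_trans le; apply: ge_inf; last by exists m', e', lab'.
by exists 0 => _ [m0 [e0 [lab0 [_ ->]]]]; apply: tree_width_ge0.
Qed.
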